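(* Consider a finite MDP $\langle\mathcal S,\mathcal A,(\mathcal A(s),s\in\mathcal S),P,r\rangle$ (with $r$ interpreted as a cost) such that the Markov chain under every randomized stationary policy $u\in\mathcal U^{\rm RS}$ is ergodic (irreducible and aperiodic), and let $\alpha\in(0,1]$. (a) The optimal value $\mathrm{VaR}^*:=\inf_{u\in\mathcal U^{\rm RS}}\mathrm{VaR}^u$ of the steady-state VaR minimization MDP is given by $$\mathrm{VaR}^*=\min_{\lambda\in\Lambda}\Big\{\lambda:\ \max_{u\in\mathcal U^{\rm DS}}F^u(\lambda)\ge\alpha\Big\}.$$ (b) Suppose $u^*\in\mathcal U^{\rm DS}$ is an optimal deterministic stationary policy of the probabilistic maximization MDP with target $\mathrm{VaR}^*$, i.e. $F^{u^*}(\mathrm{VaR}^* )=\sup_{u\in\mathcal U^{\rm RS}}F^u(\mathrm{VaR}^* )$. Then $u^*$ is also optimal for the steady-state VaR minimization MDP, i.e. $\mathrm{VaR}^{u^*}=\mathrm{VaR}^*$.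
   Context: MDP: $\mathcal S$ and $\mathcal A$ are finite sets; $\mathcal A(s)\subseteq\mathcal A$ is the nonempty set of admissible actions in $s$, with $\cup_s\mathcal A(s)=\mathcal A$; $\mathcal K:=\{(s,a):s\in\mathcal S,a\in\mathcal A(s)\}$; $P(\cdot|s,a)$ is a probability distribution on $\mathcal S$ for each $(s,a)\in\mathcal K$; $r:\mathcal K\to\mathbb R$ is the instantaneous cost. Policies: $\mathcal U^{\rm RS}$ is the set of randomized stationary policies, i.e. maps $s\mapsto u(\cdot|s)$ with $u(\cdot|s)$ a probability distribution on $\mathcal A(s)$; $\mathcal U^{\rm DS}$ is the subset of deterministic ones (maps $u:\mathcal S\to\mathcal A$ with $u(s)\in\mathcal A(s)$). Under $u$, the state process is a Markov chain on $\mathcal S$ with transition matrix $\sum_{a}u(a|s)P(s'|s,a)$, and $\pi^u(s,a):=\lim_{t\to\infty}\mathbb P^u_{s_0}(s_t=s,a_t=a)$, which by ergodicity exists and does not depend on $s_0$. Steady-state quantities: $R^u_\infty$ is the random variable $r(s,a)$ with $(s,a)\sim\pi^u$; $\Lambda:=\{r(s,a):(s,a)\in\mathcal K\}$; for $\lambda\in\mathbb R$, $F^u(\lambda):=\mathbb P(R^u_\infty\le\lambda)$; $\mathrm{VaR}^u:=\inf\{\lambda\in\mathbb R:F^u(\lambda)\ge\alpha\}$. *)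

(* Defs.v *)
From HB Require Import structures.
From mathcomp Require Import all_boot all_order all_algebra.
From mathcomp Require Import all_classical all_reals all_analysis.
Set Implicit Arguments.
Unset Strict Implicit.
Unset Printing Implicit Defensive.
Import Order.TTheory GRing.Theory Num.Theory.
Import numFieldNormedType.Exports.
Local Open Scope classical_set_scope.
Local Open Scope ring_scope.

(* [trans] and [cost] are total; only their values at the admissible pairs
   [a \in adm s] are ever constrained or used. *)
Record mdp (R : realType) (S A : finType) := MDP {
  adm : S -> {set A};
  trans : S -> A -> S -> R;
  cost : S -> A -> R;
  adm_nonempty : forall s, exists a, a \in adm s;
  adm_cover : forall a, exists s, a \in adm s;
  trans_ge0 : forall s a s', a \in adm s -> 0 <= trans s a s';
  trans_sum1 : forall s a, a \in adm s -> \sum_(s' : S) trans s a s' = 1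
}.

Section FiniteChain.
Context (R : realType) (S : finType).
Implicit Type p : S -> S -> R.

Fixpoint nstep p (n : nat) (s s' : S) : R :=
  if n is m.+1 then \sum_(k : S) nstep p m s k * p k s' else (s == s')%:R.

Definition irreducible_chain p : Prop :=
  forall s s', exists n, 0 < nstep p n s s'.

(* The gcd of the return times of each state is 1. *)
Definition aperiodic_chain p : Prop :=
  forall s (d : nat),
    (forall n, (0 < n)%N -> 0 < nstep p n s s -> (d %| n)%N) -> d = 1%N.

Definition ergodic_chain p : Prop := irreducible_chain p /\ aperiodic_chain p.

End FiniteChain.

Section SteadyState.
Context (R : realType) (S A : finType) (M : mdp R S A).
Implicit Types (u : S -> A -> R) (d : {ffun S -> A}) (s : S) (l alpha : R).

(* [u s a] stands for u(a|s), extended by 0 to the inadmissible actions. *)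
Definition randomized_policy : set (S -> A -> R) :=
  [set u | forall s,
     [/\ forall a, 0 <= u s a,
         forall a, a \notin adm M s -> u s a = 0 &
         \sum_(a in adm M s) u s a = 1]].

Definition deterministic_policy d : bool := [forall s, d s \in adm M s].

Definition policy_of d : S -> A -> R := fun s a => (a == d s)%:R.

Definition policy_chain u : S -> S -> R :=
  fun s s' => \sum_(a in adm M s) u s a * trans M s a s'.

(* The probability of s_t = s, a_t = a for the process started at s0. *)
Definition state_action_prob u s0 (t : nat) (s : S) (a : A) : R :=
  nstep (policy_chain u) t s0 s * u s a.

(* The initial state s0 is kept as a parameter: the limit does not depend on it
   when the chain is ergodic. *)
Definition steady_state u s0 (s : S) (a : A) : R :=
  limn (fun t => state_action_prob u s0 t s a).

Definition steady_cdf u s0 l : R :=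
  \sum_(x : S * A | (x.2 \in adm M x.1) && (cost M x.1 x.2 <= l))
    steady_state u s0 x.1 x.2.

Definition cost_values : set R :=
  [set l | exists s a, a \in adm M s /\ l = cost M s a].

Definition VaR alpha u s0 : R := inf [set l | alpha <= steady_cdf u s0 l].

Definition VaR_opt alpha s0 : R :=
  inf [set VaR alpha u s0 | u in randomized_policy].

(* The base value 0 is harmless: there is always a deterministic policy, and
   the steady-state distribution functions are nonnegative. *)
Definition max_deterministic_cdf s0 l : R :=
  \big[Num.max/0]_(d : {ffun S -> A} | deterministic_policy d)
    steady_cdf (policy_of d) s0 l.

End SteadyState.

Definition is_minimum (R : realType) (E : set R) (m : R) : Prop :=
  E m /\ lbound E m.

(* Main.v *)
(* Ergodicity gives, by a Doeblin contraction, a unique and positive limit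
   distribution for every randomized policy.  If pi_a is the limit distribution
   of the policy obtained from u by always playing a at the state s, then that
   of u is a convex combination of the pi_a, so some a does not decrease
   F^u(l); treating the states one after the other, F^u(l) <= F^d(l) for a
   deterministic d.  Each F^u is a step function jumping only in Lambda, so
   VaR^u is the least l in Lambda with F^u(l) >= alpha, and both claims
   follow. *)
Require Import Defs.
From HB Require Import structures.
From mathcomp Require Import all_boot all_order all_algebra.
From mathcomp Require Import all_classical all_reals all_analysis.
Import Order.TTheory GRing.Theory Num.Theory.
Import numFieldNormedType.Exports.
Local Open Scope classical_set_scope.
Local Open Scope ring_scope.

Set Implicit Arguments.
Unset Strict Implicit.
Unset Printing Implicit Defensive.

(** * Additive submonoids of the naturals with gcd 1 *)

Lemma addn_closed_cofinite (T : nat -> Prop) :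
  T 0%N -> (forall m n, T m -> T n -> T (m + n)%N) ->
  (forall d, (forall n, T n -> (d %| n)%N) -> d = 1%N) ->
  exists N, forall n, (N <= n)%N -> T n.
Proof.
move=> T0 TD Tgcd.
have TM k n : T n -> T (k * n)%N.
  by move=> Tn; elim: k => [//|k IH]; rewrite mulSn; apply: TD.
pose gap d := (0 < d)%N /\ exists n, T n /\ T (n + d)%N.
have [d0 gap_d0] : exists d, gap d.
  (* Without a gap [T] would contain only 0, and 2 would divide all of it. *)
  apply: contrapT => nogap; suff : 2%N = 1%N by [].
  apply: Tgcd => -[|n] Tn //.
  by exfalso; apply: nogap; exists n.+1; split => //; exists 0%N.
have exgap : exists d, `[< gap d >] by exists d0; apply/asboolP.
case: (ex_minnP exgap) => d /asboolP[d_gt0 [n [Tn Tnd]]] dmin.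
(* The least gap d between two elements of T divides every m in T: otherwise
   m %% d would be a smaller gap. *)
have d1 : d = 1%N.
  apply: Tgcd => m Tm; rewrite /dvdn; apply: contraT; rewrite -lt0n => r_gt0.
  suff : (d <= m %% d)%N by rewrite leqNgt ltn_pmod.
  apply: dmin; apply/asboolP; split => //.
  (* With q = [m %/ d], the elements q(n + d) and qn + m differ by [m %% d]. *)
  exists ((m %/ d) * (n + d))%N; split; first exact: TM.
  rewrite mulnDr -addnA -divn_eq; apply: TD => //; exact: TM.
rewrite {}d1 in Tnd.
exists (n * n)%N => m le_nn_m.
case: n Tn Tnd le_nn_m => [|n] Tn Tnd le_nn_m.
  by rewrite -(muln1 m); apply: TM.
have le_rq : (m %% n.+1 <= m %/ n.+1)%N.
  apply: (@leq_trans n.+1); first by rewrite ltnW // ltn_pmod.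
  by rewrite leq_divRL.
(* A combination of two consecutive elements of [T]; the square bound on [m] keeps the first
   coefficient from truncating. *)
have -> : m = ((m %/ n.+1 - m %% n.+1) * n.+1 + (m %% n.+1) * (n.+1 + 1))%N.
  by rewrite mulnDr muln1 addnA -mulnDl subnK // -divn_eq.
by apply: TD; apply: TM.
Qed.

(** * Convergence of finite ergodic chains *)

Section Chain.
Context (R : realType) (S : finType).
Implicit Types (p : S -> S -> R) (s : S).

Definition stochastic p : Prop :=
  (forall s s', 0 <= p s s') /\ forall s, \sum_s' p s s' = 1.

Lemma sum_eq1E s (f : S -> R) : \sum_k (s == k)%:R * f k = f s.
Proof.
rewrite (bigD1 s) //= eqxx mul1r big1 ?addr0 // => k.
by rewrite eq_sym => /negbTE ->; rewrite mul0r.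
Qed.

Lemma nstepD p m n s s' :
  nstep p (m + n) s s' = \sum_k nstep p m s k * nstep p n k s'.
Proof.
elim: n s' => [|n IH] s'.
  rewrite addn0 /=; under eq_bigr do rewrite mulrC eq_sym.
  by rewrite sum_eq1E.
rewrite addnS /=; under eq_bigr do rewrite IH big_distrl /=.
rewrite exchange_big /=; apply: eq_bigr => k _.
by rewrite big_distrr /=; apply: eq_bigr => j _; rewrite mulrA.
Qed.

Lemma nstep_stochastic p n : stochastic p -> stochastic (nstep p n).
Proof.
move=> [p0 p1]; elim: n => [|n [IH0 IH1]].
  split=> [s s'|s] /=; first by rewrite ler0n.
  by under eq_bigr do rewrite -[_%:R]mulr1; rewrite sum_eq1E.
split=> [s s'|s] /=; first by apply: sumr_ge0 => k _; rewrite mulr_ge0.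
rewrite exchange_big /= -[RHS](IH1 s); apply: eq_bigr => k _.
by rewrite -big_distrr /= p1 mulr1.
Qed.

Lemma nstepD_gt0 p m n s k s' : stochastic p ->
  0 < nstep p m s k -> 0 < nstep p n k s' -> 0 < nstep p (m + n) s s'.
Proof.
move=> pst mgt0 ngt0; rewrite nstepD (bigD1 k) //=.
rewrite ltr_wpDr ?mulr_gt0 //; apply: sumr_ge0 => j _.
by rewrite mulr_ge0 //; apply: (nstep_stochastic _ pst).1.
Qed.

(** The return times of a state form an additive monoid of gcd 1, so all large times are return
    times. Following them by one path from [s] to [s'] makes every large time work for that pair,
    and there are finitely many pairs. *)
Lemma ergodic_primitive p : stochastic p -> ergodic_chain p ->
  exists N, forall s s', 0 < nstep p N s s'.
Proof.
move=> pst [irr aper].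
have returns s : exists N, forall n, (N <= n)%N -> 0 < nstep p n s s.
  apply: addn_closed_cofinite => [|m n|d dvd_d].
  - by rewrite /= eqxx ltr01.
  - exact: nstepD_gt0.
  - by apply: (aper s) => n _; apply: dvd_d.
have reach (x : S * S) :
    exists N, forall n, (N <= n)%N -> 0 < nstep p n x.1 x.2.
  have [N HN] := returns x.1; have [m Hm] := irr x.1 x.2.
  exists (N + m)%N => n le_n.
  have le_mn : (m <= n)%N by apply: leq_trans le_n; rewrite leq_addl.
  rewrite -(subnK le_mn); apply: nstepD_gt0 Hm => //.
  by apply: HN; rewrite leq_subRL // addnC.
have [K HK] := choice reach.
exists (\max_x K x)%N => s s'.
exact: (HK (s, s') _ (leq_bigmax (s, s'))).
Qed.

(** Doeblin contraction: each row of [q] is the constant [e] plus a nonnegative remainder of mass 1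
    - |S|e. The constant part contributes equally to all averages, so only the remainder can spread
    them. *)
Lemma stochastic_average (q : S -> S -> R) (h : S -> R) (e b c : R) :
  stochastic q -> (forall s k, e <= q s k) ->
  (forall s, b <= h s <= b + c) ->
  exists b', forall s,
    b' <= \sum_k q s k * h k <= b' + (1 - #|S|%:R * e) * c.
Proof.
move=> [_ q1] qe hb.
exists (e * \sum_k h k + (1 - #|S|%:R * e) * b) => s.
have -> : \sum_k q s k * h k
    = e * (\sum_k h k) + \sum_k (q s k - e) * h k.
  rewrite big_distrr -big_split /=; apply: eq_bigr => k _.
  by rewrite -mulrDl subrKC.
have sumE (y : R) : (1 - #|S|%:R * e) * y = \sum_k (q s k - e) * y.
  by rewrite -big_distrl /= sumrB q1 sumr_const mulr_natl.
rewrite -addrA -mulrDr !lerD2l !sumE.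
by apply/andP; split; apply: ler_sum => k _;
  rewrite ler_wpM2l ?subr_ge0 //; have /andP[] := hb k.
Qed.

Lemma ergodic_minorized p : stochastic p -> ergodic_chain p ->
  exists N, exists2 e, 0 < e & forall s s', e <= nstep p N s s'.
Proof.
move=> pst perg; have [N HN] := ergodic_primitive pst perg.
exists N, (\big[Num.min/1]_(x : S * S) nstep p N x.1 x.2) => [|s s'].
  by apply: lt_bigmin => // x _; apply: HN.
exact: (@bigmin_le _ _ _ _ (s, s') (fun x => nstep p N x.1 x.2)).
Qed.

(** Each block of [N] steps contracts the column of [s'] once more; [n] extra steps only average
    that column, so the same interval serves all later times. *)
Lemma nstep_oscillation p N e s' : stochastic p ->
  (forall s k, e <= nstep p N s k) ->
  forall k, exists b, forall n s,
    b <= nstep p (k * N + n) s s' <= b + (1 - #|S|%:R * e) ^+ k.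
Proof.
move=> pst pe.
suff H k : exists b, forall s,
    b <= nstep p (k * N) s s' <= b + (1 - #|S|%:R * e) ^+ k.
  move=> k; have [b hb] := H k; exists b => n s.
  have [n0 n1] := nstep_stochastic n pst.
  have sumE (y : R) : y = \sum_j nstep p n s j * y.
    by rewrite -big_distrl /= n1 mul1r.
  rewrite addnC nstepD [leLHS]sumE [b + _]sumE.
  by apply/andP; split; apply: ler_sum => j _; rewrite ler_wpM2l //;
    have /andP[] := hb j.
elim: k => [|k [b hb]].
  exists 0 => s; rewrite add0r expr0 /=.
  by case: eqP => _; rewrite /= ?lexx ler01.
have [b' hb'] := stochastic_average (nstep_stochastic N pst) pe hb.
by exists b' => s; rewrite mulSn nstepD exprS.
Qed.

Lemma ergodic_cvg p s' : stochastic p -> ergodic_chain p ->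
  exists l : R, forall s, nstep p n s s' @[n --> \oo] --> l.
Proof.
move=> pst perg; have [N [e e0 pe]] := ergodic_minorized pst perg.
set rho := 1 - #|S|%:R * e.
have rho0 : 0 <= rho.
  rewrite subr_ge0 mulr_natl -sumr_const -((nstep_stochastic N pst).2 s').
  by apply: ler_sum => k _.
have rho1 : rho < 1.
  rewrite ltrBlDr ltrDl mulr_gt0 // ltr0n; apply/card_gt0P; by exists s'.
have osc := nstep_oscillation s' pst pe.
have small (eps : R) : 0 < eps -> exists k, rho ^+ k < eps.
  move=> eps0; have : rho ^+ k @[k --> \oo] --> (0 : R).
    by apply: cvg_expr; rewrite ger0_norm.
  move=> /cvgrPdist_lt /(_ _ eps0) [k _ /(_ k (leqnn k))].
  by rewrite /= sub0r normrN ger0_norm ?exprn_ge0 // => ?; exists k.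
(* Varying the time gives the Cauchy property; varying the starting state makes all rows share one
   limit. *)
have close (eps : R) : 0 < eps -> exists K, forall m n s s1,
    (K <= m)%N -> (K <= n)%N -> `|nstep p m s s' - nstep p n s1 s'| < eps.
  move=> eps0; have [k ltk] := small _ eps0.
  have [b hb] := osc k; exists (k * N)%N => m n s s1 lem len.
  have := hb (m - k * N)%N s; have := hb (n - k * N)%N s1.
  rewrite !subnKC // => /andP[h1 h2] /andP[h3 h4].
  apply: le_lt_trans ltk; rewrite ler_norml; apply/andP; split.
    by rewrite lerBrDr addrC lerBlDr (le_trans h2) // lerD2r.
  by rewrite lerBlDr (le_trans h4) // addrC lerD2l.
have cvs : cvgn (fun n => nstep p n s' s').
  apply/cauchy_cvgP/cauchy_exP => eps eps0.
  have [K HK] := close _ eps0.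
  exists (nstep p K s' s'); exists K => // n /= leKn.
  exact: HK.
exists (limn (fun n => nstep p n s' s')) => s.
apply/cvgrPdist_lt => eps eps0.
have eps20 : 0 < eps / 2 by rewrite divr_gt0.
have [K HK] := close _ eps20.
move/cvgrPdist_lt: cvs => /(_ _ eps20) [K' _ HK'].
exists (maxn K K') => // n /=; rewrite geq_max => /andP[leK leK'].
rewrite (splitr eps) -(subrKA (nstep p n s' s')).
apply: le_lt_trans (ler_normD _ _) _.
apply: ltrD; [exact: HK' | exact: HK].
Qed.

(** * The limit distribution: mass, stationarity, positivity, uniqueness *)

Definition limit_distribution p s0 s : R := limn (fun t => nstep p t s0 s).

Section Limit.
Context p (pst : stochastic p) (perg : ergodic_chain p) (s0 : S).
Local Notation pi := (limit_distribution p s0).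

Lemma limit_distribution_cvg s s' : nstep p n s s' @[n --> \oo] --> pi s'.
Proof.
have [l Hl] := ergodic_cvg s' pst perg.
by rewrite /limit_distribution (cvg_lim (@Rhausdorff R) (Hl s0)).
Qed.

(** A constant [f] yields total mass 1, a column of [p] yields stationarity. *)
Lemma cvg_limit_distribution_sum (f : S -> R) :
  \sum_k nstep p n s0 k * f k @[n --> \oo] --> \sum_k pi k * f k.
Proof.
apply: cvg_big => [|k _]; first exact: add_continuous.
by apply: cvgMr_tmp; apply: limit_distribution_cvg.
Qed.

Lemma limit_distribution_sum1 : \sum_s pi s = 1.
Proof.
under eq_bigr do rewrite -[limit_distribution _ _ _]mulr1.
apply: (cvg_unique _ (@cvg_limit_distribution_sum (fun=> 1))) => //.
apply: cvg_near_cst; near=> n.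
under eq_bigr do rewrite mulr1.
exact: (nstep_stochastic n pst).2.
Unshelve. all: by end_near. Qed.

Lemma limit_distribution_stationary s' : \sum_s pi s * p s s' = pi s'.
Proof.
apply: (cvg_unique _ (@cvg_limit_distribution_sum (p ^~ s'))) => //.
have := @limit_distribution_cvg s0 s'.
by rewrite -(cvg_shiftS (fun n => nstep p n s0 s')).
Qed.

(** Wherever the chain is [N] steps before time [n], it ends in [s] with probability at least [e];
    the limit inherits this bound. *)
Lemma limit_distribution_gt0 s : 0 < pi s.
Proof.
have [N [e e0 pe]] := ergodic_minorized pst perg.
apply: lt_le_trans e0 _.
have cv := @limit_distribution_cvg s0 s.
rewrite -(cvg_lim (@Rhausdorff R) cv).
apply: limr_ge; first by apply/cvg_ex; exists (pi s).
exists N => // n /= leNn.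
rewrite -(subnK leNn) nstepD -[e]mul1r.
have [n0 n1] := nstep_stochastic (n - N) pst.
rewrite -(n1 s0) big_distrl /=; apply: ler_sum => k _.
by rewrite ler_wpM2l.
Qed.

(** [mu] is invariant under every power of [p], whose rows tend to [pi]. The mass of [mu] is left
    free so that unnormalised mixtures can be treated. *)
Lemma stationary_unique (mu : S -> R) :
  (forall s', \sum_s mu s * p s s' = mu s') ->
  forall s, mu s = (\sum_k mu k) * pi s.
Proof.
move=> mup s'.
have mun n s : \sum_k mu k * nstep p n k s = mu s.
  elim: n s => [|n IH] s /=.
    by under eq_bigr do rewrite eq_sym mulrC; rewrite sum_eq1E.
  under eq_bigr do rewrite big_distrr /=.
  rewrite exchange_big -[RHS]mup /=; apply: eq_bigr => k _.
  by rewrite -IH big_distrl /=; apply: eq_bigr => j _; rewrite mulrA.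
have cv : \sum_k mu k * nstep p n k s' @[n --> \oo]
    --> \sum_k mu k * pi s'.
  apply: cvg_big => [|k _]; first exact: add_continuous.
  by apply: cvgMl_tmp; apply: limit_distribution_cvg.
rewrite big_distrl /=.
apply: (cvg_unique _ _ cv) => //.
by apply: cvg_near_cst; near=> n; apply: mun.
Unshelve. all: by end_near. Qed.

End Limit.
End Chain.

(** * Policies, and fixing the action at one state *)

Section Policy.
Context (R : realType) (S A : finType) (M : mdp R S A).
Implicit Types (u : S -> A -> R) (s : S) (l : R).

Lemma policy_chain_stochastic u : randomized_policy M u ->
  stochastic (policy_chain M u).
Proof.
move=> uP; split=> [s s'|s].
  apply: sumr_ge0 => a aM; have [u0 _ _] := uP s.
  by rewrite mulr_ge0 // trans_ge0.
have [_ _ u1] := uP s; rewrite exchange_big -[RHS]u1 /=.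
by apply: eq_bigr => a aM; rewrite -big_distrr /= trans_sum1 // mulr1.
Qed.

Lemma policy_of_randomized (d : {ffun S -> A}) :
  deterministic_policy M d -> randomized_policy M (policy_of R d).
Proof.
move=> /forallP dM s; split=> [a|a aM|].
- exact: ler0n.
- by rewrite /policy_of; case: eqP => // ad; rewrite ad dM in aM.
- rewrite (bigD1 (d s)) //= /policy_of eqxx big1 ?addr0 // => a /andP[_].
  by move=> /negbTE ->.
Qed.

Definition fix_action u s a : S -> A -> R :=
  fun x b => if x == s then (b == a)%:R else u x b.

Lemma fix_action_randomized u s a : a \in adm M s ->
  randomized_policy M u -> randomized_policy M (fix_action u s a).
Proof.
move=> aM uP x; rewrite /fix_action; case: eqP => [->|_]; last exact: uP.
split=> [b|b bM|]; first exact: ler0n.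
- by case: eqP => // ba; rewrite ba aM in bM.
- by rewrite (bigD1 a) //= eqxx big1 ?addr0 // => b /andP[_ /negbTE ->].
Qed.

Lemma policy_chain_fix_action u s a x y : a \in adm M s ->
  policy_chain M (fix_action u s a) x y =
  if x == s then trans M s a y else policy_chain M u x y.
Proof.
move=> aM; rewrite /policy_chain /fix_action; case: eqP => [->|//].
rewrite (bigD1 a) //= eqxx mul1r big1 ?addr0 // => b /andP[_ /negbTE ->].
by rewrite mul0r.
Qed.

Context (Herg : forall u, randomized_policy M u ->
                  ergodic_chain (policy_chain M u)).
Context (s0 : S).

Local Notation pi u := (limit_distribution (policy_chain M u) s0).

Lemma steady_stateE u s a : randomized_policy M u ->
  steady_state M u s0 s a = pi u s * u s a.
Proof.
move=> uP; apply: cvg_lim => //; apply: cvgMr_tmp.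
exact: limit_distribution_cvg (policy_chain_stochastic uP) (Herg uP) _ _ _.
Qed.

(* With the weights u(a|s) / pi_a(s), the sum mu of the pi_a has mass
   mu(s) = 1 and flow u(a|s) through the pair (s, a), so mu is stationary
   for u. *)
Lemma steady_state_mixture u s : randomized_policy M u ->
  exists w : A -> R, [/\ forall a, 0 <= w a, \sum_(a in adm M s) w a = 1 &
    forall x b, steady_state M u s0 x b =
      \sum_(a in adm M s) w a * steady_state M (fix_action u s a) s0 x b].
Proof.
move=> uP; have [u0 uadm u1] := uP s.
have faP a (aM : a \in adm M s) := fix_action_randomized aM uP.
have pi_gt0 v x : randomized_policy M v -> 0 < pi v x.
  move=> vP.
  exact: limit_distribution_gt0 (policy_chain_stochastic vP) (Herg vP) _ _.
pose v a := pi (fix_action u s a).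
have v_gt0 a x : a \in adm M s -> 0 < v a x by move=> aM; apply/pi_gt0/faP.
pose w' a := u s a / v a s.
have w'0 a : 0 <= w' a.
  have [aM|aM] := boolP (a \in adm M s).
    by rewrite divr_ge0 // ltW // v_gt0.
  by rewrite /w' uadm // mul0r.
pose mu x := \sum_(a in adm M s) w' a * v a x.
have mus : mu s = 1.
  rewrite -u1; apply: eq_bigr => a aM.
  by rewrite divfK // gt_eqF // v_gt0.
have mu_stat y : \sum_x mu x * policy_chain M u x y = mu y.
  (* Stationarity of [v a] with the term at [s] isolated, the only place where its chain differs
     from that of [u]. *)
  have vy a : a \in adm M s -> v a y = v a s * trans M s a y +
      \sum_(x | x != s) v a x * policy_chain M u x y.
    move=> aM.
    have faMP := faP a aM.
    rewrite -[LHS](limit_distribution_stationary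
      (policy_chain_stochastic faMP) (Herg faMP)).
    rewrite (bigD1 s) //= policy_chain_fix_action // eqxx; congr (_ + _).
    by apply: eq_bigr => x /negbTE xs; rewrite policy_chain_fix_action // xs.
  rewrite (bigD1 s) //= mus mul1r.
  under [RHS]eq_bigr => a aM do
    rewrite vy // mulrDr mulrA divfK ?gt_eqF ?v_gt0 //.
  rewrite big_split /=; congr (_ + _).
  under eq_bigr do rewrite big_distrl /=.
  rewrite exchange_big /=; apply: eq_bigr => a _.
  by rewrite big_distrr /=; apply: eq_bigr => x _; rewrite mulrA.
have mu_pi :=
  stationary_unique (policy_chain_stochastic uP) (Herg uP) s0 mu_stat.
set W := \sum_k mu k in mu_pi.
(* Each [v a] has mass 1, so dividing by [W] normalises [mu] and the weights at once. *)
have WE : W = \sum_(a in adm M s) w' a.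
  rewrite /W exchange_big /=; apply: eq_bigr => a aM.
  have faMP := faP a aM; rewrite -big_distrr /=.
  by rewrite (limit_distribution_sum1
    (policy_chain_stochastic faMP) (Herg faMP)) mulr1.
have W_gt0 : 0 < W.
  rewrite -(pmulr_lgt0 _ (pi_gt0 u s uP)) -mu_pi mus; exact: ltr01.
have W0 : W != 0 by rewrite gt_eqF.
exists (fun a => w' a / W); split=> [a||x b].
- by rewrite divr_ge0 // ltW.
- by rewrite -big_distrl /= -WE divff.
rewrite steady_stateE //.
have -> : pi u x = mu x / W by rewrite mu_pi mulrAC divff // mul1r.
under eq_bigr => a aM do
  rewrite (steady_stateE _ _ (faP a aM)) -[limit_distribution _ _ x]/(v a x)
    /fix_action.
(* Away from [s] all these policies play like [u]. At [s] only the term [a = b] survives, and its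
   weight restores u(b|s). *)
have [->|_] := eqVneq x s; last first.
  rewrite /mu !big_distrl /=; apply: eq_bigr => a _.
  by rewrite mulrA; congr (_ * _); rewrite mulrAC.
rewrite mus mul1r.
have [bM|bM] := boolP (b \in adm M s); last first.
  rewrite uadm // mulr0 big1 // => a aM.
  by case: eqP => [ba|]; rewrite ?mulr0 // ba aM in bM *.
rewrite (bigD1 b) //= eqxx mulr1 big1 ?addr0; last first.
  by move=> a /andP[_ ab]; rewrite eq_sym (negbTE ab) !mulr0.
by rewrite mulrAC divfK 1?mulrC // gt_eqF // v_gt0.
Qed.

(** F^u(l) is linear in the steady state, hence a weighted average of the values for the fixed
    actions; the largest of these is at least the average. *)
Lemma steady_cdf_fix_action u s l : randomized_policy M u ->
  exists2 a, a \in adm M s &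
    steady_cdf M u s0 l <= steady_cdf M (fix_action u s a) s0 l.
Proof.
move=> uP; have [w [w0 w1 wE]] := steady_state_mixture s uP.
have [a0 a0M] := adm_nonempty M s.
pose F a := steady_cdf M (fix_action u s a) s0 l.
have FE : steady_cdf M u s0 l = \sum_(a in adm M s) w a * F a.
  rewrite /steady_cdf; under eq_bigr do rewrite wE.
  by rewrite exchange_big /=; apply: eq_bigr => a _; rewrite big_distrr.
case: (@arg_maxP _ _ _ a0 [in adm M s] F a0M) => a aM Fa; exists a => //.
rewrite FE -[leRHS]mul1r -w1 big_distrl /=; apply: ler_sum => b bM.
by rewrite ler_wpM2l //; apply: Fa.
Qed.

Lemma steady_cdf_deterministic u l : randomized_policy M u ->
  exists2 d : {ffun S -> A}, deterministic_policy M d &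
    steady_cdf M u s0 l <= steady_cdf M (policy_of R d) s0 l.
Proof.
move=> uP.
(* Induction on the states already made deterministic; fixing the action at one more state keeps the
   others deterministic. *)
have det_on (r : seq S) : exists v, [/\ randomized_policy M v,
    steady_cdf M u s0 l <= steady_cdf M v s0 l &
    forall s, s \in r ->
      exists2 a, a \in adm M s & forall b, v s b = (b == a)%:R].
  elim: r => [|s r [v [vP le_uv vdet]]]; first by exists u.
  have [a aM le_va] := steady_cdf_fix_action s l vP.
  exists (fix_action v s a); split=> [||x].
  - exact: fix_action_randomized.
  - exact: le_trans le_va.
  - rewrite inE /fix_action; case: eqP => [-> _|_ /= /vdet //].
    by exists a.
have [v [vP le_uv vdet]] := det_on (enum S).
have {}vdet s : exists a, a \in adm M s /\ forall b, v s b = (b == a)%:R.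
  by have [|a] := vdet s; [rewrite mem_enum | exists a].
have [d Hd] := choice vdet.
exists [ffun s => d s].
  by apply/forallP => s; rewrite ffunE; apply: (Hd s).1.
suff -> : policy_of R [ffun s => d s] = v by [].
by apply/funext => s; apply/funext => b; rewrite /policy_of ffunE (Hd s).2.
Qed.

(** * Cost values and quantiles *)

Lemma steady_state_sum1 u : randomized_policy M u ->
  \sum_(x : S * A | x.2 \in adm M x.1) steady_state M u s0 x.1 x.2 = 1.
Proof.
move=> uP.
rewrite -(limit_distribution_sum1 (policy_chain_stochastic uP) (Herg uP) s0).
rewrite -(pair_big_dep predT (fun s a => a \in adm M s)
  (fun s a => steady_state M u s0 s a)) /=.
apply: eq_bigr => s _; under eq_bigr do rewrite steady_stateE //.
by rewrite -big_distrr /=; have [_ _ ->] := uP s; rewrite mulr1.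
Qed.

(** Indexing by the finite type of pairs gives access to [arg_minP] and [arg_maxP]. *)
Lemma cost_valuesP l : cost_values M l <->
  exists2 x : S * A, x.2 \in adm M x.1 & l = cost M x.1 x.2.
Proof.
split=> [[s [a [aM ->]]]|[[s a] /= aM ->]]; first by exists (s, a).
by exists s, a.
Qed.

(** Serves both for the quantile of a single policy and for the minimum in (a). *)
Lemma cost_values_min (P : R -> Prop) :
  (exists2 l, cost_values M l & P l) ->
  exists2 m, cost_values M m /\ P m &
    forall l, cost_values M l -> P l -> m <= l.
Proof.
case=> l /cost_valuesP[x0 x0M ->] Px0.
pose Q := [pred x : S * A | (x.2 \in adm M x.1) && `[< P (cost M x.1 x.2) >]].
have Qx0 : Q x0 by rewrite /= x0M; apply/asboolP.
case: (@arg_minP _ _ _ x0 Q (fun x => cost M x.1 x.2) Qx0).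
move=> x /andP[xM /asboolP Px] xmin; exists (cost M x.1 x.2).
  by split=> //; apply/cost_valuesP; exists x.
move=> _ /cost_valuesP[y yM ->] Py; apply: xmin.
by rewrite /= yM; apply/asboolP.
Qed.

Lemma cost_values_max : exists2 m, cost_values M m &
  forall l, cost_values M l -> l <= m.
Proof.
have [a0 a0M] := adm_nonempty M s0.
pose Q := [pred x : S * A | x.2 \in adm M x.1].
case: (@arg_maxP _ _ _ (s0, a0) Q (fun x => cost M x.1 x.2) a0M) => x xM xmax.
exists (cost M x.1 x.2); first by apply/cost_valuesP; exists x.
by move=> _ /cost_valuesP[y yM ->]; apply: xmax.
Qed.

Lemma steady_cdf_eq1 u m : randomized_policy M u ->
  (forall l, cost_values M l -> l <= m) -> steady_cdf M u s0 m = 1.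
Proof.
move=> uP mmax; rewrite -(steady_state_sum1 uP); apply: eq_bigl => x.
rewrite andb_idr // => xM; apply: mmax; apply/cost_valuesP; by exists x.
Qed.

(** Take the largest admissible cost not above [l]; a nonzero value ensures that there is one. *)
Lemma steady_cdf_cost_value u l : steady_cdf M u s0 l != 0 ->
  exists2 l', cost_values M l' /\ l' <= l &
    steady_cdf M u s0 l' = steady_cdf M u s0 l.
Proof.
pose Q := [pred x : S * A | (x.2 \in adm M x.1) && (cost M x.1 x.2 <= l)].
move=> F0.
have [x0 Qx0] : exists x0, Q x0.
  apply: contrapT => noQ; case/eqP: F0; apply: big_pred0 => x.
  by apply/negP => Qx; apply: noQ; exists x.
case: (@arg_maxP _ _ _ x0 Q (fun x => cost M x.1 x.2) Qx0).
move=> x /andP[xM xl] xmax.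
exists (cost M x.1 x.2); first by split=> //; apply/cost_valuesP; exists x.
apply: eq_bigl => y; apply: andb_id2l => yM; apply/idP/idP => [yx|yl].
  exact: le_trans xl.
by apply: xmax; rewrite /= yM.
Qed.

Context (alpha : R) (alpha0 : 0 < alpha) (alpha1 : alpha <= 1).

(** The infimum is attained, at a cost: [alpha <= 1] lets the largest cost qualify, and [0 < alpha]
    forces any qualifying level to lie above a qualifying cost or equal it. *)
Lemma VaR_min u : randomized_policy M u ->
  [/\ cost_values M (VaR M alpha u s0),
      alpha <= steady_cdf M u s0 (VaR M alpha u s0) &
      forall l, alpha <= steady_cdf M u s0 l -> VaR M alpha u s0 <= l].
Proof.
move=> uP.
have [|m [mL mF] mmin] :=
    @cost_values_min (fun l => alpha <= steady_cdf M u s0 l).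
  have [m mL mmax] := cost_values_max; exists m => //.
  by rewrite (steady_cdf_eq1 uP).
have mlb l : alpha <= steady_cdf M u s0 l -> m <= l.
  move=> lF; have [|l' [l'L l'l] l'F] := @steady_cdf_cost_value u l.
    by rewrite gt_eqF // (lt_le_trans alpha0).
  by apply: le_trans l'l; apply: mmin; rewrite ?l'F.
suff -> : VaR M alpha u s0 = m by split.
apply/eqP; rewrite eq_le; apply/andP; split.
  by apply: ge_inf => //; exists m.
by apply: lb_le_inf => //; exists m.
Qed.
End Policy.

Theorem theorem7 (R : realType) (S A : finType) (M : mdp R S A)
    (Herg : forall u : S -> A -> R, randomized_policy M u ->
              ergodic_chain (policy_chain M u))
    (alpha : R) (Halpha0 : 0 < alpha) (Halpha1 : alpha <= 1) (s0 : S) :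
  is_minimum
    [set l : R | cost_values M l /\ alpha <= max_deterministic_cdf M s0 l]
    (VaR_opt M alpha s0)
  /\
  (forall d : {ffun S -> A}, deterministic_policy M d ->
     steady_cdf M (policy_of R d) s0 (VaR_opt M alpha s0)
       = sup [set steady_cdf M u s0 (VaR_opt M alpha s0)
                | u in randomized_policy M] ->
     VaR M alpha (policy_of R d) s0 = VaR_opt M alpha s0).
Proof.
have VaRP := VaR_min Herg s0 Halpha0 Halpha1.
have cdf_le_max u l : randomized_policy M u ->
    steady_cdf M u s0 l <= max_deterministic_cdf M s0 l.
  move=> uP; have [d dM le_ud] := steady_cdf_deterministic Herg s0 l uP.
  by apply: le_trans le_ud _; apply: le_bigmax_cond.
have [d0 d0M] : exists d : {ffun S -> A}, deterministic_policy M d.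
  have [f fM] := choice (adm_nonempty M).
  by exists (finfun f); apply/forallP => s; rewrite ffunE.
have d0P := policy_of_randomized d0M.
(* [v] is the right-hand side of (a); the VaR of [d0] shows that its set is nonempty. *)
have [|v [vL vF] vmin] :=
    @cost_values_min _ _ _ M (fun l => alpha <= max_deterministic_cdf M s0 l).
  have [L_d0 F_d0 _] := VaRP _ d0P.
  exists (VaR M alpha (policy_of R d0) s0) => //.
  exact: le_trans (cdf_le_max _ _ d0P).
have v_le u : randomized_policy M u -> v <= VaR M alpha u s0.
  move=> uP; have [L_u F_u _] := VaRP _ uP.
  by apply: vmin => //; apply: le_trans (cdf_le_max _ _ uP).
have [d1 d1M d1F] : exists2 d : {ffun S -> A}, deterministic_policy M d &
    alpha <= steady_cdf M (policy_of R d) s0 v.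
  apply: contrapT => nod; move: vF; rewrite leNgt => /negP; apply.
  (* The base value 0 of the maximum lies below [alpha], so a maximum reaching [alpha] is reached by
     a policy. *)
  apply/bigmax_ltP; split=> // d dM; rewrite ltNge; apply/negP => Fd.
  by apply: nod; exists d.
have d1P := policy_of_randomized d1M.
have VaR_optE : VaR_opt M alpha s0 = v.
  apply/eqP; rewrite eq_le; apply/andP; split.
    have [_ _ d1min] := VaRP _ d1P.
    apply: le_trans (d1min _ d1F); apply: ge_inf.
      by exists v => _ [u uP <-]; apply: v_le.
    by exists (policy_of R d1).
  apply: lb_le_inf => [|_ [u uP <-]]; last exact: v_le.
  by exists (VaR M alpha (policy_of R d0) s0), (policy_of R d0).
rewrite VaR_optE; split.
  by split=> // l [lL lF]; apply: vmin.
move=> d dM dsup; have dP := policy_of_randomized dM.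
apply/eqP; rewrite eq_le v_le // andbT.
have [_ _ dmin] := VaRP _ dP; apply: dmin.
(* The supremum dominates the value of [d1] at [v], so [d] also reaches [alpha] there and its VaR is
   at most [v]. *)
apply: le_trans d1F _; rewrite dsup.
apply: ub_le_sup; last by exists (policy_of R d1).
by exists (max_deterministic_cdf M s0 v) => _ [u uP <-]; apply: cdf_le_max.
Qed.
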